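(* Let $n\ge 2$ be an integer and let $Q=[q_0,\dots,q_{n-1}]$ be any real orthogonal $n\times n$ matrix with first column $q_0=\mathbf 1/\sqrt n$. Define \[ M(Q):=\sup_{1\le j\le n-1}\ \sup_{0\le k,l\le n-1}n\,|q_j(k)q_j(l)|=n\max_{1\le j\le n-1}\|q_j\|_\infty^2 . \] Let $\lambda_1,\dots,\lambda_{n-1}\le 0$ be real numbers and $\Lambda=\operatorname{diag}(1,\lambda_1,\dots,\lambda_{n-1})$. If \[ 1+\sum_{j=1}^{n-1}\lambda_j>1-\frac1{M(Q)}, \] then $P(\Lambda)=Q\Lambda Q^{\top}$ is symmetric and doubly stochastic.
   Context: $\mathbf 1$ denotes the all-ones vector in $\mathbb R^n$, and coordinates of vectors are indexed by $0,\dots,n-1$. A real square matrix is doubly stochastic if its entries are non-negative and all its row sums and column sums equal $1$. *)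

(* Defs.v *)
From mathcomp Require Import all_boot all_order all_algebra sesquilinear.
From mathcomp Require Import all_classical all_reals all_analysis.
Set Implicit Arguments.
Unset Strict Implicit.
Unset Printing Implicit Defensive.

Import Order.TTheory GRing.Theory Num.Theory.
Import numFieldNormedType.Exports.
Local Open Scope classical_set_scope.
Local Open Scope ring_scope.

Definition orthogonal_mx (R : realType) (n : nat) (Q : 'M[R]_n) : Prop :=
  Q^T *m Q = 1%:M.

Definition doubly_stochastic (R : realType) (n : nat) (A : 'M[R]_n) : Prop :=
  [/\ forall i j, 0 <= A i j,
      forall i, \sum_j A i j = 1 &
      forall j, \sum_i A i j = 1].

(* The vector q_j is the column j of Q, so q_j(k) is Q k j. *)
Definition Mcoh (R : realType) (n : nat) (Q : 'M[R]_n) : R :=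
  sup [set sup [set n%:R * `|Q k j * Q l j| | k in [set: 'I_n] & l in [set: 'I_n]]
      | j in [set j : 'I_n | (0 < j)%N]].

(* diag (1, lam_1, .., lam_(n-1)); the value of lam at index 0 is not used. *)
Definition Lambda_mx (R : realType) (n : nat) (lam : 'I_n -> R) : 'M[R]_n :=
  diag_mx (\row_(j < n) if (j == 0 :> nat)%N then 1 else lam j).

Definition P_mx (R : realType) (n : nat) (Q L : 'M[R]_n) : 'M[R]_n :=
  Q *m L *m Q^T.

(* Main.v *)
Require Import Defs.
From mathcomp Require Import all_boot all_order all_algebra sesquilinear.
From mathcomp Require Import all_classical all_reals all_analysis.
Set Implicit Arguments.
Unset Strict Implicit.
Unset Printing Implicit Defensive.

Import Order.TTheory GRing.Theory Num.Theory.
Import numFieldNormedType.Exports.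
Local Open Scope classical_set_scope.
Local Open Scope ring_scope.

(** The first column of [Q] is the normalised all-ones vector, and it is an
    eigenvector of [P := Q Lambda Q^T] for the eigenvalue [1].  Hence the rows
    of [P] sum to [1], and so do the columns because [P] is symmetric
    ([orthogonal_diag_row_sum], [orthogonal_diag_symmetric]).

    Only nonnegativity of the entries is at stake.  Isolating the first column,
    [P k l = 1/n + \sum_(j > 0) lam_j q_j(k) q_j(l)].  Each [lam_j] is
    nonpositive and [q_j(k) q_j(l) <= M/n] with [M := Mcoh Q], so
    [n * P k l >= 1 + M * \sum_(j > 0) lam_j], which is positive exactly when
    the sum of the [lam_j] exceeds [- 1/M] ([nonpos_weighted_sum_ge]).

    The two suprema defining [M] range over finite families, so they are
    attained; the inner one is attained at [k = l], where [q_j] takes its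
    sup norm ([sup_col_products], [McohE]). *)

Lemma sup_attained (R : realType) (A : set R) (x : R) :
  A x -> ubound A x -> sup A = x.
Proof.
move=> Ax ubx; apply/eqP; rewrite eq_le ge_sup //=; last by exists x.
by apply: ub_le_sup => //; exists x.
Qed.

Lemma norm_col_ge (R : realType) (m n : nat) (Q : 'M[R]_(m, n)) (k : 'I_m)
  (j : 'I_n) : `|Q k j| <= `|col j Q|.
Proof.
rewrite [leRHS]/Num.norm /= mx_normrE.
by apply/bigmax_geP; right; exists (k, ord0) => //=; rewrite mxE.
Qed.

Lemma norm_col_attained (R : realType) (m n : nat) (Q : 'M[R]_(m.+1, n))
  (j : 'I_n) : exists k, `|col j Q| = `|Q k j|.
Proof.
have -> : `|col j Q| = mx_norm (col j Q) by []; rewrite mx_normrE.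
have [//|[k i] _ ->] := @eq_bigmax _ R _ 0 (ord0, ord0) xpredT
  (fun ij : 'I_m.+1 * 'I_1 => `|col j Q ij.1 ij.2|) isT.
by exists k; rewrite mxE.
Qed.

(** The inner supremum is the squared sup norm: [|q_j(k) q_j(l)|] is bounded by
    it, with equality when [k = l] is a coordinate of maximal modulus. *)
Lemma sup_col_products (R : realType) (n : nat) (Q : 'M[R]_n) (j : 'I_n) :
  sup [set n%:R * `|Q k j * Q l j| | k in [set: 'I_n] & l in [set: 'I_n]] =
  n%:R * `|col j Q| ^+ 2.
Proof.
case: n Q j => [|n] Q j; first by case: j.
apply: sup_attained => [|_ [k _ [l _ <-]]].
  have [k ->] := norm_col_attained Q j.
  by exists k => //; exists k => //; rewrite normrM expr2.
by rewrite normrM expr2 ler_wpM2l // ler_pM // norm_col_ge.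
Qed.

Lemma McohE (R : realType) (n : nat) (Q : 'M[R]_n) : (2 <= n)%N ->
  Mcoh Q = n%:R * \big[Num.max/0]_(j < n | (0 < j)%N) `|col j Q| ^+ 2.
Proof.
move=> hn; rewrite /Mcoh; apply: sup_attained => [|_ [j j0 <-]].
  have [j _|j j0 ->] := @eq_bigmax _ R _ 0 (Ordinal hn)
    (fun j : 'I_n => (0 < j)%N) (fun j => `|col j Q| ^+ 2) isT.
    exact: sqr_ge0.
  by exists j => //; rewrite sup_col_products.
by rewrite sup_col_products ler_wpM2l // (le_bigmax_cond 0).
Qed.

Lemma mulmx_tr_entry (R : comPzRingType) (n : nat) (Q : 'M[R]_n) (d : 'rV[R]_n)
  (k l : 'I_n) :
  (Q *m diag_mx d *m Q^T) k l = \sum_j d 0 j * (Q k j * Q l j).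
Proof.
rewrite mxE; apply: eq_bigr => j _.
by rewrite mul_mx_diag !mxE mulrAC mulrC.
Qed.

Lemma orthogonal_diag_eigencol (R : comPzRingType) (n : nat) (Q : 'M[R]_n)
  (d : 'rV[R]_n) (j : 'I_n) : Q^T *m Q = 1%:M ->
  Q *m diag_mx d *m Q^T *m col j Q = d 0 j *: col j Q.
Proof.
move=> hQ; rewrite [in LHS]colE mulmxA -(mulmxA _ Q^T) hQ mulmx1 -colE.
by apply/matrixP=> k i; rewrite mul_mx_diag !mxE mulrC.
Qed.

Lemma orthogonal_diag_symmetric (R : comPzRingType) (n : nat) (Q : 'M[R]_n)
  (d : 'rV[R]_n) : (Q *m diag_mx d *m Q^T)^T = Q *m diag_mx d *m Q^T.
Proof. by rewrite !trmx_mul trmxK tr_diag_mx mulmxA. Qed.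

(** Being proportional to the all-ones vector, column [o] is an eigenvector for
    the eigenvalue [1]; each of its coordinates then reads as a row sum. *)
Lemma orthogonal_diag_row_sum (R : realType) (n : nat) (Q : 'M[R]_n) (d : 'rV[R]_n)
    (o : 'I_n) : orthogonal_mx Q ->
    col o Q = (Num.sqrt n%:R)^-1 *: const_mx 1 -> d 0 o = 1 ->
  forall k, \sum_l (Q *m diag_mx d *m Q^T) k l = 1.
Proof.
move=> hQ hq d1 k.
have n0 : Num.sqrt n%:R != 0 :> R.
  by rewrite sqrtr_eq0 -ltNge ltr0n (leq_ltn_trans _ (ltn_ord o)).
have := orthogonal_diag_eigencol d o hQ.
rewrite d1 scale1r hq -scalemxAr => /(scalerI (invr_neq0 n0)) /matrixP/(_ k 0).
rewrite !mxE => <-; apply: eq_bigr => l _.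
by rewrite [const_mx _ _ _]mxE mulr1.
Qed.

(** The contribution of the columns other than the first is bounded below by
    replacing each product [q_j(k) q_j(l)] by its upper bound, which can only
    decrease the sum since the weights are nonpositive. *)
Lemma nonpos_weighted_sum_ge (R : realType) (n : nat) (Q : 'M[R]_n)
    (lam : 'I_n -> R) (k l : 'I_n) :
    (forall j : 'I_n, (0 < j)%N -> lam j <= 0) ->
  (\sum_(j < n | (0 < j)%N) lam j) *
    \big[Num.max/0]_(j < n | (0 < j)%N) `|col j Q| ^+ 2 <=
  \sum_(j < n | (0 < j)%N) lam j * (Q k j * Q l j).
Proof.
move=> hlam; rewrite mulr_suml; apply: ler_sum => j j0.
apply: ler_wnM2l; first exact: hlam.
apply: (le_trans (ler_norm _)).
apply: le_trans (le_bigmax_cond 0 (fun j => `|col j Q| ^+ 2) j0).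
by rewrite normrM expr2 ler_pM // norm_col_ge.
Qed.

Theorem lemma9 (R : realType) (n : nat) (hn : (2 <= n)%N) (Q : 'M[R]_n)
    (hQ : orthogonal_mx Q)
    (hq0 : forall j : 'I_n, j = 0%N :> nat ->
       col j Q = (Num.sqrt n%:R)^-1 *: const_mx 1) :
  Mcoh Q = n%:R * \big[Num.max/0]_(j < n | (0 < j)%N) `|col j Q| ^+ 2 /\
  forall lam : 'I_n -> R,
    (forall j : 'I_n, (0 < j)%N -> lam j <= 0) ->
    1 - (Mcoh Q)^-1 < 1 + \sum_(j < n | (0 < j)%N) lam j ->
    P_mx Q (Lambda_mx lam) \is symmetricmx /\
    doubly_stochastic (P_mx Q (Lambda_mx lam)).
Proof.
split=> [|lam hlam]; first exact: McohE.
rewrite ltrD2l => hsum.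
have hn0 : (0 < n)%N by apply: ltnW.
pose o := Ordinal hn0.
have nR0 : 0 < n%:R :> R by rewrite ltr0n.
rewrite /P_mx /Lambda_mx; set d := (X in diag_mx X).
have hsym := orthogonal_diag_symmetric Q d.
have hrow : forall k, \sum_l (Q *m diag_mx d *m Q^T) k l = 1.
  by apply: (orthogonal_diag_row_sum hQ (hq0 o erefl)); rewrite mxE.
split.
  by rewrite is_hermitianmxE expr0 scale1r map_mx_id // hsym.
split=> [k l||k]; [|exact: hrow|]; last first.
  by rewrite -(hrow k); apply: eq_bigr => i _; rewrite -[in LHS]hsym mxE.
have hfirst i : Q i o = (Num.sqrt n%:R)^-1.
  by have /matrixP/(_ i 0) := hq0 o erefl; rewrite !mxE mulr1.
rewrite mulmx_tr_entry (bigD1 o) //= {1}mxE mul1r !hfirst -invfM.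
rewrite -expr2 sqr_sqrtr ?ler0n //.
have -> : \sum_(j < n | j != o) d 0 j * (Q k j * Q l j) =
          \sum_(j < n | (0 < j)%N) lam j * (Q k j * Q l j).
  apply: eq_big => [j|j]; first by rewrite -val_eqE lt0n.
  by rewrite -val_eqE mxE => /negPf ->.
have := nonpos_weighted_sum_ge Q k l hlam.
move: hsum; rewrite (McohE Q hn).
set S := \sum_(j < n | _) lam j; set B := \big[_/_]_(j < n | _) _ => hsum hge.
have S0 : S <= 0 by apply: sumr_le0.
(* If every q_j with j > 0 vanished, then 1/M = 0 and hsum would read 0 < S. *)
have B0 : 0 < B.
  rewrite lt_neqAle bigmax_ge_id andbT eq_sym; apply/eqP => B0.
  by move: hsum; rewrite B0 mulr0 invr0 oppr0 ltNge S0.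
apply: le_trans (lerD (lexx _) hge).
move: hsum; rewrite -subr_gt0 opprK invfM => hsum.
(* B = M / n, so the lower bound 1/n + S * B is B times the slack S + 1/M. *)
have -> : n%:R^-1 + S * B = (S + n%:R^-1 * B^-1) * B.
  by rewrite mulrDl mulfVK ?gt_eqF // addrC.
by rewrite mulr_ge0 // ltW.
Qed.
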